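(* Let $\mathfrak{g}$ be a Lie algebra (not necessarily arising from a Lie group). For each $n\in\{1,2,3\}$, the space $(\mathfrak{g}^{D_n})_0=\{f\in\mathfrak{g}^{D_n}\mid f(0)=0\}$, equipped with the binary operation $*$ defined below, is a Lie group. The operation is given, with $d$ denoting the generic element of $D_n$, as follows. 1. For $n=1$: $(dX_1)*(dY_1)=d(X_1+Y_1)$. 2. For $n=2$: $\left(dX_1+\tfrac12 d^2X_2\right)*\left(dY_1+\tfrac12 d^2Y_2\right)=d(X_1+Y_1)+\tfrac12 d^2\left(X_2+Y_2+[X_1,Y_1]\right)$. 3. For $n=3$: $$\left(dX_1+\tfrac12 d^2X_2+\tfrac16 d^3X_3\right)*\left(dY_1+\tfrac12 d^2Y_2+\tfrac16 d^3Y_3\right)=d(X_1+Y_1)+\tfrac12 d^2\left(X_2+Y_2+[X_1,Y_1]\right)+\tfrac16 d^3\left\{X_3+Y_3+\tfrac32\left([X_1,Y_2]+[X_2,Y_1]\right)+\tfrac12[X_1-Y_1,[X_1,Y_1]]\right\}.$$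
   Context: The setting is synthetic differential geometry (SDG; intuitionistic reasoning). $\mathbb{R}$ is the line, a commutative unital $\mathbb{Q}$-algebra satisfying the general Kock–Lawvere axiom for all Weil algebras. $D_n=\{d\in\mathbb{R}\mid d^{n+1}=0\}$ and $D=D_1$. A space $M$ is microlinear if $M^{(-)}$ sends to a limit diagram every finite diagram of infinitesimal spaces (spectra of Weil algebras) with cocone that $\mathbb{R}^{(-)}$ sends to a limit diagram. An $\mathbb{R}$-module $\mathbb{E}$ is Euclidean if for each $f:D\to\mathbb{E}$ there is a unique $b\in\mathbb{E}$ with $f(d)=f(0)+db$ for all $d\in D$. A Lie group is a group that is microlinear as a space. A Lie algebra is a Euclidean $\mathbb{R}$-module, microlinear as a space, with a bilinear, antisymmetric bracket $[\,,\,]$ satisfying the Jacobi identity. Every element of $(\mathfrak{g}^{D_n})_0$ is uniquely of the form $d\mapsto dX_1+\tfrac12 d^2X_2+\dots+\tfrac1{n!}d^nX_n$ with $X_1,\dots,X_n\in\mathfrak{g}$. *)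

(* Defs.v *)
(* Spaces are types, maps of spaces are functions, and the ambient logic is the
   intuitionistic logic of Rocq.  The algebraic structures of MathComp are not
   usable here: their carriers are choice types, hence have decidable equality,
   which together with the Kock-Lawvere axiom forces 1 = 0 in the line.  Rings
   below are Stdlib's [ring_theory] for Leibniz equality.

   There is no unique choice from Prop to Type, so "for every x there is a
   unique y" is expressed, in Prop, by the existence of the function x |-> y
   ([bijective] of ssrfun, or an explicit [exists] of that function).  In a
   topos, where unique choice holds, the two readings agree. *)
Set Warnings "-notation-overridden".
From Stdlib Require Import Ring_theory Ring ZArith QArith Qcanon.
From mathcomp Require Import all_boot.

Set Implicit Arguments.
Unset Strict Implicit.
Unset Printing Implicit Defensive.

Declare Scope sdg_scope.
Delimit Scope sdg_scope with sdg.

Record cring := CRing {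
  cr_car :> Type;
  cr0 : cr_car;
  cr1 : cr_car;
  cr_add : cr_car -> cr_car -> cr_car;
  cr_mul : cr_car -> cr_car -> cr_car;
  cr_opp : cr_car -> cr_car;
  cr_theory : ring_theory cr0 cr1 cr_add cr_mul
                (fun x y => cr_add x (cr_opp y)) cr_opp (@eq cr_car) }.

Definition cr_exp (R : cring) (x : R) (n : nat) : R :=
  iter n (cr_mul x) (cr1 R).

Record ring_hom (A B : cring) (f : A -> B) : Prop := RingHom {
  rh1 : f (cr1 A) = cr1 B;
  rhD : forall x y, f (cr_add x y) = cr_add (f x) (f y);
  rhM : forall x y, f (cr_mul x y) = cr_mul (f x) (f y) }.

Definition Qc_cring : cring := CRing Qcrt.

(* A Weil algebra over R is R (+) N with N a nilpotent ideal, free of finite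
   rank as an R-module; N is the kernel of the augmentation [wa_aug]. *)
Record weil_algebra (R : cring) := WeilAlgebra {
  wa_ring :> cring;
  wa_scal : R -> wa_ring;
  wa_aug : wa_ring -> R;
  wa_dim : nat;
  wa_basis : 'I_wa_dim -> wa_ring;
  wa_scal_hom : ring_hom wa_scal;
  wa_aug_hom : ring_hom wa_aug;
  wa_augK : cancel wa_scal wa_aug;
  wa_basis_aug : forall i, wa_aug (wa_basis i) = cr0 R;
  wa_basisP : bijective (fun p : R * ('I_wa_dim -> R) =>
    cr_add (wa_scal p.1)
      (\big[@cr_add wa_ring/cr0 wa_ring]_(i < wa_dim)
          cr_mul (wa_scal (p.2 i)) (wa_basis i)));
  wa_nilpotent : exists k : nat, forall u : 'I_k -> wa_ring,
    (forall i, wa_aug (u i) = cr0 R) ->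
    \big[@cr_mul wa_ring/cr1 wa_ring]_(i < k) u i = cr0 wa_ring }.

Definition Spec (R : cring) (W : weil_algebra R) : Type :=
  {phi : W -> R | ring_hom phi /\ forall a, phi (wa_scal W a) = a}.

Definition kock_lawvere (R : cring) : Prop :=
  forall W : weil_algebra R,
    bijective (fun (w : W) (phi : Spec W) => sval phi w).

Record line := Line {
  line_ring :> cring;
  line_rat : Qc_cring -> line_ring;
  line_rat_hom : ring_hom line_rat;
  line_kl : kock_lawvere line_ring }.

Definition frac (L : line) (a : Z) (b : positive) : L :=
  line_rat L (Q2Qc (Qmake a b)).
Arguments frac L a%_Z b%_positive.

(* The shape of a finite diagram is a finite directed graph: a functor from a
   finite category has the same limits as its underlying graph of maps. *)
Record inf_cocone (R : cring) := InfCocone {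
  ic_vert : finType;
  ic_edge : finType;
  ic_src : ic_edge -> ic_vert;
  ic_tgt : ic_edge -> ic_vert;
  ic_obj : ic_vert -> weil_algebra R;
  ic_map : forall e, Spec (ic_obj (ic_src e)) -> Spec (ic_obj (ic_tgt e));
  ic_apex : weil_algebra R;
  ic_leg : forall v, Spec (ic_obj v) -> Spec ic_apex;
  ic_comm : forall e (x : Spec (ic_obj (ic_src e))),
    ic_leg (ic_map x) = ic_leg x }.

Arguments ic_src {R} i e.
Arguments ic_tgt {R} i e.
Arguments ic_obj {R} i v.
Arguments ic_map {R} i e x.
Arguments ic_leg {R} i v x.

Section Limit.
Variables (R : cring) (M : Type) (C : inf_cocone R).

Definition lim_pow : Type :=
  {h : forall v, Spec (ic_obj C v) -> M |
    forall e x, h (ic_tgt C e) (ic_map C e x) = h (ic_src C e) x}.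

Lemma pow_cone_subproof (f : Spec (ic_apex C) -> M) e x :
  f (ic_leg C (ic_tgt C e) (ic_map C e x)) = f (ic_leg C (ic_src C e) x).
Proof. by rewrite ic_comm. Qed.

Definition pow_cone (f : Spec (ic_apex C) -> M) : lim_pow :=
  exist _ (fun v x => f (ic_leg C v x)) (pow_cone_subproof f).

Definition sends_to_limit : Prop := bijective pow_cone.

End Limit.

Definition microlinear (R : cring) (M : Type) : Prop :=
  forall C : inf_cocone R, sends_to_limit R C -> sends_to_limit M C.

Definition D (R : cring) (n : nat) : Type :=
  {d : R | cr_exp d n.+1 = cr0 R}.

Lemma cr_mul0 (R : cring) (x : R) : cr_mul (cr0 R) x = cr0 R.
Proof.
exact: (ARmul_0_l (Rth_ARth (Eqsth R) (Eq_ext _ _ _) (cr_theory R)) x).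
Qed.

Lemma cr_exp0 (R : cring) n : cr_exp (cr0 R) n.+1 = cr0 R.
Proof. exact: cr_mul0. Qed.

Definition D0 (R : cring) (n : nat) : D R n := exist _ (cr0 R) (cr_exp0 R n).

Record rmodule (R : cring) := RModule {
  md_car :> Type;
  md0 : md_car;
  md_add : md_car -> md_car -> md_car;
  md_opp : md_car -> md_car;
  md_scale : R -> md_car -> md_car;
  md_addA : associative md_add;
  md_addC : commutative md_add;
  md_add0 : left_id md0 md_add;
  md_addN : left_inverse md0 md_opp md_add;
  md_scaleA : forall a b x,
    md_scale a (md_scale b x) = md_scale (cr_mul a b) x;
  md_scale1 : forall x, md_scale (cr1 R) x = x;
  md_scaleDr : forall a x y,
    md_scale a (md_add x y) = md_add (md_scale a x) (md_scale a y);
  md_scaleDl : forall a b x,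
    md_scale (cr_add a b) x = md_add (md_scale a x) (md_scale b x) }.

Notation "x + y" := (md_add x y) : sdg_scope.
Notation "- x" := (md_opp x) : sdg_scope.
Notation "x - y" := (md_add x (md_opp y)) : sdg_scope.
Notation "a *: x" := (md_scale a x) (at level 40) : sdg_scope.

Local Open Scope sdg_scope.

Definition euclidean (R : cring) (E : rmodule R) : Prop :=
  exists deriv : (D R 1 -> E) -> E, forall f : D R 1 -> E,
    unique (fun b : E => forall d, f d = f (D0 R 1) + sval d *: b) (deriv f).

Record lie_algebra (L : line) := LieAlgebra {
  la_mod :> rmodule L;
  la_br : la_mod -> la_mod -> la_mod;
  la_euclidean : euclidean la_mod;
  la_microlinear : microlinear L la_mod;
  la_brDl : forall x y z, la_br (x + y) z = la_br x z + la_br y z;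
  la_brDr : forall x y z, la_br x (y + z) = la_br x y + la_br x z;
  la_brZl : forall a x y, la_br (a *: x) y = a *: la_br x y;
  la_brZr : forall a x y, la_br x (a *: y) = a *: la_br x y;
  la_brC : forall x y, la_br x y = - la_br y x;
  la_jacobi : forall x y z,
    la_br x (la_br y z) + la_br y (la_br z x) + la_br z (la_br x y)
      = md0 la_mod }.

Notation "[ 'lie' x , y ]" := (la_br x y)
  (format "[ 'lie'  x ,  y ]") : sdg_scope.

Definition is_group (G : Type) (mul : G -> G -> G) : Prop :=
  associative mul /\
  exists (e : G) (inv : G -> G),
    [/\ left_id e mul, right_id e mul,
        left_inverse e inv mul & right_inverse e inv mul].

Definition is_lie_group (R : cring) (G : Type) (mul : G -> G -> G) : Prop :=
  is_group mul /\ microlinear R G.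

Section Jets.
Variables (L : line) (g : lie_algebra L).

Definition jets (n : nat) : Type :=
  {f : D L n -> g | f (D0 L n) = md0 g}.

Lemma md_scale0 (x : g) : cr0 L *: x = md0 g.
Proof.
have h : cr0 L *: x = cr0 L *: x + cr0 L *: x.
  by rewrite -md_scaleDl (Radd_0_l (cr_theory L)).
have := congr1 (md_add (- (cr0 L *: x))) h.
by rewrite md_addA md_addN md_add0.
Qed.

Lemma jet_term0 (q : L) (n : nat) (X : g) :
  cr_mul q (cr_exp (cr0 L) n.+1) *: X = md0 g.
Proof. by rewrite cr_exp0 (Rmul_comm (cr_theory L)) cr_mul0 md_scale0. Qed.

Definition jet1_fun (X1 : g) (d : D L 1) : g := sval d *: X1.

Definition jet2_fun (X1 X2 : g) (d : D L 2) : g :=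
  sval d *: X1 + cr_mul (frac L 1 2) (cr_exp (sval d) 2) *: X2.

Definition jet3_fun (X1 X2 X3 : g) (d : D L 3) : g :=
  sval d *: X1 + cr_mul (frac L 1 2) (cr_exp (sval d) 2) *: X2
               + cr_mul (frac L 1 6) (cr_exp (sval d) 3) *: X3.

Lemma jet1_fun0 X1 : jet1_fun X1 (D0 L 1) = md0 g.
Proof. exact: md_scale0. Qed.

Lemma jet2_fun0 X1 X2 : jet2_fun X1 X2 (D0 L 2) = md0 g.
Proof. by rewrite /jet2_fun jet_term0 md_scale0 md_add0. Qed.

Lemma jet3_fun0 X1 X2 X3 : jet3_fun X1 X2 X3 (D0 L 3) = md0 g.
Proof.
by rewrite /jet3_fun !jet_term0 md_scale0 !md_add0.
Qed.

Definition jet1 X1 : jets 1 := exist _ (jet1_fun X1) (jet1_fun0 X1).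
Definition jet2 X1 X2 : jets 2 := exist _ (jet2_fun X1 X2) (jet2_fun0 X1 X2).
Definition jet3 X1 X2 X3 : jets 3 :=
  exist _ (jet3_fun X1 X2 X3) (jet3_fun0 X1 X2 X3).

End Jets.

(* Main.v *)
Set Warnings "-notation-overridden,-redundant-canonical-projection".
Require Import Defs.
From HB Require Import structures.
From Stdlib Require Import Ring_theory Ring ZArith QArith Qcanon.
From Stdlib Require Import FunctionalExtensionality ProofIrrelevance.
From mathcomp Require Import all_boot.

Set Implicit Arguments.
Unset Strict Implicit.
Unset Printing Implicit Defensive.

(** The group laws are the Baker-Campbell-Hausdorff series truncated at degree
    n: for jets of curves, z = x + y + 1/2 [x,y] + 1/12 [x-y,[x,y]] read in
    degrees 1, 2, 3 and rescaled by 1!, 2!, 3! gives the three formulas.  In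
    coordinates (X1, X2, X3) they are group laws on g, g^2 and g^3, with unit
    0 and inverse the coordinatewise opposite; associativity in degree 3
    amounts to one Jacobi identity ([law3_group]).

    The coordinates are where the geometry lies.  It has to be shown that X
    |-> (d |-> X_0 + d X_1 + .. + d^n X_n) is a bijection from g^(n+1) onto
    g^(D_n) ([taylor]), given only that g is Euclidean, which is the case
    n = 1, and microlinear.  More generally ([vector_kock_lawvere]), let W be
    a Weil algebra with basis b_0 = 1, .., b_m.  Let D(k) be the set of
    (d_1, .., d_k) with d_i d_j = 0 for all i, j, and let k = m + 1.  To a
    function f on Spec W one attaches the function (d, phi) |-> d f(phi) on
    D x Spec W, which vanishes on {0} x Spec W.  Collapsing {0} x Spec W to a
    point turns D x Spec W, as far as functions into the line can tell, into
    D(k), along the map (d, phi) |-> (d phi(b_0), .., d phi(b_m)): both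
    function algebras are R + W as modules.  Microlinearity transfers this to
    functions into g ([cyl_cone_limit]), so d f(phi) = F(d phi(b_0), ..) for a
    unique F on D(k).  As D(k) is, again for functions into the line, the
    union of its k axes glued at 0 ([axes_cone_limit]), F is determined by its
    restrictions to the axes, which are linear since g is Euclidean:
    F(d_1, .., d_k) = sum d_i X_i ([axes_linear]).  Hence
    d f(phi) = d (sum phi(b_i) X_i) for all d in D, and d can be cancelled.

    The bijection identifies the jets vanishing at 0 with g^n, hence
    transports the group laws, and also microlinearity, which a product
    inherits from its factors.

    The whole argument is constructive: excluded middle together with the
    Kock-Lawvere axiom would collapse the line to a point. *)

(** * Subset types and finite choice *)

Lemma sval_eq (T : Type) (P : T -> Prop) (u v : {x | P x}) :
  sval u = sval v -> u = v.
Proof. by apply: eq_sig_hprop => x p q; apply: proof_irrelevance. Qed.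

(** Induction on an enumeration, constructively valid because equality on a
    finite type is decidable.  It turns the inverses of the evaluation maps,
    which the Kock-Lawvere axiom provides one Weil algebra at a time, into a
    single family indexed by the vertices of a diagram. *)
Lemma finite_choice (T : finType) (B : T -> Type) (P : forall t, B t -> Prop) :
  (forall t, exists y : B t, P t y) ->
  exists f : forall t, B t, forall t, P t (f t).
Proof.
move=> exP.
have [f fP] : exists f : forall t, t \in enum T -> B t,
    forall t h, P t (f t h).
  elim: (enum T) => [|a s [f fP]].
    have g t : t \in [::] -> B t by rewrite in_nil.
    by exists g => t h; have := h; rewrite {1}in_nil.
  have [y yP] := exP a.
  have in_tail t : t \in a :: s -> t <> a -> t \in s.
    by rewrite in_cons => /orP [/eqP|].
  exists (fun t h => match eq_comparable t a with
    | left e => eq_rect_r B y e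
    | right ne => f t (in_tail t h ne)
    end) => t h.
  by case: eq_comparable => [e|ne]; [subst t | apply: fP].
by exists (fun t => f t (mem_enum T t)) => t; apply: fP.
Qed.

(** * Commutative rings *)

Declare Scope cr_scope.
Delimit Scope cr_scope with cr.
Notation "0" := (cr0 _) : cr_scope.
Notation "1" := (cr1 _) : cr_scope.
Notation "x + y" := (cr_add x y) : cr_scope.
Notation "x * y" := (cr_mul x y) : cr_scope.
Notation "- x" := (cr_opp x) : cr_scope.
Notation "x ^+ n" := (cr_exp x n) : cr_scope.

Section RingLemmas.
Variable R : cring.
Local Open Scope cr_scope.
Add Ring R_ring : (cr_theory R).

Lemma cr_addA : associative (@cr_add R). Proof. by move=> x y z; ring. Qed.
Lemma cr_addC : commutative (@cr_add R). Proof. by move=> x y; ring. Qed.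
Lemma cr_add0 : left_id 0 (@cr_add R). Proof. by move=> x; ring. Qed.
Lemma cr_mulA : associative (@cr_mul R). Proof. by move=> x y z; ring. Qed.
Lemma cr_mulC : commutative (@cr_mul R). Proof. by move=> x y; ring. Qed.
Lemma cr_mul1 : left_id 1 (@cr_mul R). Proof. by move=> x; ring. Qed.
Lemma cr_mulr1 : right_id 1 (@cr_mul R). Proof. by move=> x; ring. Qed.
Lemma cr_addr0 : right_id 0 (@cr_add R). Proof. by move=> x; ring. Qed.
Lemma cr_mulr0 (x : R) : x * 0 = 0. Proof. by ring. Qed.
Lemma cr_mulDr (x y z : R) : x * (y + z) = x * y + x * z. Proof. by ring. Qed.

Lemma cr_addI (x y z : R) : x + y = x + z -> y = z.
Proof.
move=> h; have -> : y = - x + (x + y) by ring.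
by rewrite h; ring.
Qed.

End RingLemmas.

HB.instance Definition _ (R : cring) := Monoid.isComLaw.Build R (cr0 R)
  (@cr_add R) (@cr_addA R) (@cr_addC R) (@cr_add0 R).
HB.instance Definition _ (R : cring) := Monoid.isComLaw.Build R (cr1 R)
  (@cr_mul R) (@cr_mulA R) (@cr_mulC R) (@cr_mul1 R).

Notation "\csum_ ( i < n ) F" := (\big[@cr_add _/cr0 _]_(i < n) F)
  (at level 41, i, n at level 50, F at level 41,
   format "\csum_ ( i  <  n )  F") : cr_scope.
Notation "\cprod_ ( i < n ) F" := (\big[@cr_mul _/cr1 _]_(i < n) F)
  (at level 36, i, n at level 50, F at level 36,
   format "\cprod_ ( i  <  n )  F") : cr_scope.

Section RingHom.
Variables (A B : cring) (f : A -> B) (fH : ring_hom f).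
Local Open Scope cr_scope.

Lemma rh0 : f 0 = 0.
Proof. by apply: (@cr_addI _ (f 0)); rewrite -rhD // !cr_addr0. Qed.

Lemma rh_sum n (F : 'I_n -> A) : f (\csum_(i < n) F i) = \csum_(i < n) f (F i).
Proof. exact: (big_morph f (rhD fH) rh0). Qed.

Lemma rh_exp x n : f (x ^+ n) = f x ^+ n.
Proof. by elim: n => [|n IH] /=; rewrite ?(rh1 fH) // (rhM fH) IH. Qed.

End RingHom.

Lemma ring_hom_id (R : cring) : ring_hom (@id R). Proof. by []. Qed.

Lemma ring_hom_comp (A B C : cring) (f : B -> C) (h : A -> B) :
  ring_hom f -> ring_hom h -> ring_hom (f \o h).
Proof.
by move=> fH hH; split=> [|x y|x y] /=;
  rewrite ?(rh1 hH) ?(rhD hH) ?(rhM hH) ?(rh1 fH) ?(rhD fH) ?(rhM fH).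
Qed.

Section DeltaSum.
Variable R : cring.
Local Open Scope cr_scope.

Definition delta n (i j : 'I_n) : R := if i == j then 1 else 0.

Lemma sum_delta n (c : 'I_n -> R) j : \csum_(i < n) (c i * delta i j) = c j.
Proof.
rewrite (bigD1 j) //= /delta eqxx cr_mulr1 big1 ?cr_addr0 // => i /negbTE ->.
exact: cr_mulr0.
Qed.

End DeltaSum.
Arguments delta {R n} i j.

Section FunRing.
Variables (R : cring) (k : nat).
Local Open Scope cr_scope.
Add Ring FR_ring : (cr_theory R).

Lemma fun_theory : @ring_theory ('I_k -> R) (fun=> 0) (fun=> 1)
  (fun u v i => u i + v i) (fun u v i => u i * v i)
  (fun u v i => u i + - v i) (fun u i => - u i) eq.
Proof. by split=> *; apply: functional_extensionality => i; ring. Qed.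

Definition fun_ring : cring :=
  @CRing ('I_k -> R) _ _ _ _ (fun u i => - u i) fun_theory.

Lemma const_hom : ring_hom (fun (a : R) => (fun=> a) : fun_ring).
Proof. by []. Qed.

End FunRing.

(** * Weil algebras by extension *)

(** Adjoining the non-unital B-algebra A, with product u.v = x u v, to B.  With
    x = 0 the extension has square zero, which yields the coordinate rings of
    D(k) and of D x Spec W; with B = R, A = R[x]/x^(n+1) and x the class of
    the variable it is R[x]/x^(n+2), a pair (a, u) standing for a + x u. *)
Section RingExt.
Variables (B A : cring) (iota : B -> A) (iotaH : ring_hom iota) (x : A).
Local Open Scope cr_scope.
Add Ring RE_B : (cr_theory B).
Add Ring RE_A : (cr_theory A).

Definition ext_mul (p q : B * A) : B * A :=
  (p.1 * q.1, iota p.1 * q.2 + iota q.1 * p.2 + x * (p.2 * q.2)).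

Lemma ext_theory : @ring_theory (B * A) (0, 0) (1, 0)
  (fun p q => (p.1 + q.1, p.2 + q.2)) ext_mul
  (fun p q => (p.1 + - q.1, p.2 + - q.2)) (fun p => (- p.1, - p.2)) eq.
Proof.
split=> [[a u]|[a u] [b v]|[a u] [b v] [c w]|[a u]|[a u] [b v]
       |[a u] [b v] [c w]|[a u] [b v] [c w]|[a u] [b v]|[a u]];
  rewrite /ext_mul /=; congr pair;
  rewrite ?(rh1 iotaH) ?(rhM iotaH) ?(rhD iotaH); ring.
Qed.

Definition ring_ext : cring :=
  @CRing (B * A) _ _ _ _ (fun p => (- p.1, - p.2)) ext_theory.

Lemma ext_fst_hom : ring_hom (fst : ring_ext -> B). Proof. by []. Qed.

Lemma ext_inl_hom : ring_hom (fun b => (b, 0) : ring_ext).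
Proof.
by split=> // a b /=; congr pair; rewrite /= ?cr_mulr0 ?cr_addr0.
Qed.

Lemma ext_snd_sum n (F : 'I_n -> ring_ext) :
  (\csum_(i < n) F i).2 = \csum_(i < n) (F i).2.
Proof. exact: (big_morph snd). Qed.

Lemma ext_inr_mul (u v : A) :
  cr_mul ((0, u) : ring_ext) (0, v) = (0, x * (u * v)).
Proof. by congr pair => /=; rewrite ?(rh0 iotaH); ring. Qed.

End RingExt.

Section FullBasis.
Variables (R : cring) (W : weil_algebra R).
Local Open Scope cr_scope.

(** The unit completes a basis of the augmentation ideal to a basis of the
    whole algebra; index 0 is the unit. *)
Definition full_basis (i : 'I_(wa_dim W).+1) : W :=
  if unlift ord0 i is Some j then wa_basis j else 1.

Lemma full_basis0 : full_basis ord0 = 1.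
Proof. by rewrite /full_basis unlift_none. Qed.

Lemma full_basis_lift j : full_basis (lift ord0 j) = wa_basis j.
Proof. by rewrite /full_basis liftK. Qed.

Definition lin_comb (c : 'I_(wa_dim W).+1 -> R) : W :=
  \csum_(i < (wa_dim W).+1) (wa_scal W (c i) * full_basis i).

Lemma full_basis_free : bijective lin_comb.
Proof.
case: (wa_basisP W) => g gK Kg.
have eqF c : lin_comb c = wa_scal W (c ord0) + (\csum_(i < wa_dim W)
    (wa_scal W (c (lift ord0 i)) * wa_basis i)).
  rewrite /lin_comb big_ord_recl full_basis0 cr_mulr1; congr cr_add.
  by apply: eq_bigr => i _; rewrite full_basis_lift.
exists (fun w i => if unlift ord0 i is Some j then (g w).2 j else (g w).1).
- move=> c; rewrite eqF (gK (c ord0, fun i => c (lift ord0 i))) /=.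
  apply: functional_extensionality => i.
  by case: unliftP => [j|] ->.
- move=> w; rewrite eqF -[RHS]Kg /= unlift_none; congr (_ + _).
  by apply: eq_bigr => i _; rewrite liftK.
Qed.

End FullBasis.

Section WeilExt.
Variables (R : cring) (W : weil_algebra R) (A : cring).
Variables (iota : W -> A) (iotaH : ring_hom iota).
Variables (x : A) (x_nil : exists m, cr_exp x m = cr0 A).
Variables (k : nat) (b : 'I_k -> A).
Hypothesis b_free : bijective (fun c : 'I_k -> R =>
  \big[@cr_add A/cr0 A]_(i < k) cr_mul (iota (wa_scal W (c i))) (b i)).
Local Open Scope cr_scope.
Add Ring WE_A : (cr_theory A).

Let V := ring_ext iotaH x.

Definition wext_scal (a : R) : V := (wa_scal W a, 0).
Definition wext_aug (p : V) : R := wa_aug p.1.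
Definition wext_basis (i : 'I_(wa_dim W + k)) : V :=
  match split i with inl i => (wa_basis i, 0) | inr j => (0, b j) end.

Lemma wext_scal_hom : ring_hom wext_scal.
Proof. exact: ring_hom_comp (ext_inl_hom iotaH x) (wa_scal_hom W). Qed.

Lemma wext_aug_hom : ring_hom wext_aug.
Proof. exact: ring_hom_comp (wa_aug_hom W) (ext_fst_hom iotaH x). Qed.

Lemma wext_augK : cancel wext_scal wext_aug.
Proof. exact: wa_augK. Qed.

Lemma wext_basis_aug i : wext_aug (wext_basis i) = 0.
Proof.
rewrite /wext_aug /wext_basis; case: split => j; first exact: wa_basis_aug.
exact: rh0 (wa_aug_hom W).
Qed.

(** Over the base ring, the extension is the direct sum of W and A; the two
    summands of the index set carry the two bases. *)
Lemma wext_basisP : bijective (fun p : R * ('I_(wa_dim W + k) -> R) =>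
  wext_scal p.1 + \csum_(i < wa_dim W + k) (wext_scal (p.2 i) * wext_basis i)).
Proof.
case: (wa_basisP W) b_free => g gK Kg [h hK Kh].
pose F p : V := (wa_scal W p.1 + (\csum_(i < wa_dim W)
      (wa_scal W (p.2 (lshift k i)) * wa_basis i)),
   \csum_(i < k) (iota (wa_scal W (p.2 (rshift (wa_dim W) i))) * b i)).
have eqF p : wext_scal p.1 + \csum_(i < wa_dim W + k)
    (wext_scal (p.2 i) * wext_basis i) = F p.
  rewrite big_split_ord /= /F; congr pair.
    congr cr_add; rewrite !(rh_sum (ext_fst_hom iotaH x)).
    rewrite [X in _ + X]big1 ?cr_addr0; last first.
      move=> i _; rewrite /wext_basis.
      by rewrite (unsplitK (inr i : 'I_(wa_dim W) + 'I_k)) /= cr_mulr0.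
    apply: eq_bigr => i _; rewrite /wext_basis.
    by rewrite (unsplitK (inl i : 'I_(wa_dim W) + 'I_k)).
  rewrite cr_add0 !(@ext_snd_sum _ _ _ iotaH x) [X in X + _]big1 ?cr_add0; last first.
    move=> i _; rewrite /wext_basis /wext_scal.
    rewrite (unsplitK (inl i : 'I_(wa_dim W) + 'I_k)) /=; ring.
  apply: eq_bigr => i _; rewrite /wext_basis /wext_scal.
  rewrite (unsplitK (inr i : 'I_(wa_dim W) + 'I_k)) /= (rh0 iotaH); ring.
pose G (q : V) : R * ('I_(wa_dim W + k) -> R) := ((g q.1).1,
  fun i => match split i with inl i => (g q.1).2 i | inr j => h q.2 j end).
exists G => [p|q]; rewrite eqF.
- rewrite /G /= (hK (fun i => p.2 (rshift _ i))).
  rewrite (gK (p.1, fun i => p.2 (lshift _ i))) /=.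
  case: p => a c; congr pair; apply: functional_extensionality => i /=.
  by rewrite -[in RHS](splitK i); case: split.
- case: q => u v; rewrite /F /G /=; congr pair.
    rewrite -[RHS]Kg /=; congr cr_add; apply: eq_bigr => i _.
    by rewrite (unsplitK (inl i : 'I_(wa_dim W) + 'I_k)).
  rewrite -[RHS]Kh /=; apply: eq_bigr => i _.
  by rewrite (unsplitK (inr i : 'I_(wa_dim W) + 'I_k)).
Qed.

(** If products of n elements of the augmentation ideal of W vanish, a product
    of n elements of the augmentation ideal of the extension lies in A, where
    each further multiplication brings a factor x, and x is nilpotent. *)
Lemma wext_nilpotent : exists n : nat, forall u : 'I_n -> V,
  (forall i, wext_aug (u i) = 0) -> \cprod_(i < n) u i = 0.
Proof.
have [n0 n0P] := wa_nilpotent W; have [m xm] := x_nil.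
have block (u : 'I_n0 -> V) : (forall i, wext_aug (u i) = 0) ->
    exists w : A, \cprod_(i < n0) u i = (0, w).
  move=> u0; exists (\cprod_(i < n0) u i).2.
  rewrite [LHS]surjective_pairing; congr pair.
  by rewrite (big_morph fst (rhM (ext_fst_hom iotaH x)) erefl) n0P.
suff [n nP] : exists n : nat, forall u : 'I_n -> V,
    (forall i, wext_aug (u i) = 0) ->
    exists w : A, \cprod_(i < n) u i = (0, x ^+ m * w).
  by exists n => u /nP [w ->]; rewrite xm cr_mul0.
elim: m {xm} => [|m [n nP]].
  by exists n0 => u /block [w ->]; exists w; rewrite cr_mul1.
exists (n0 + n)%N => u u0; rewrite big_split_ord /=.
have [w ->] := block _ (fun i => u0 (lshift n i)).
have [w' ->] := nP _ (fun i => u0 (rshift n0 i)).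
exists (w * w'); apply: etrans (ext_inr_mul iotaH x w _) _.
by congr pair => /=; ring.
Qed.

Definition weil_ext : weil_algebra R :=
  WeilAlgebra wext_scal_hom wext_aug_hom wext_augK wext_basis_aug
    wext_basisP wext_nilpotent.

End WeilExt.

(** * The line, the axes D(k), the cylinder D x Spec W and D_n *)
Section Instances.
Variable R : cring.
Local Open Scope cr_scope.
Add Ring I_R : (cr_theory R).

Lemma ground_basisP : bijective (fun p : R * ('I_0 -> R) =>
  p.1 + \csum_(i < 0) (p.2 i * (fun=> 0) i)).
Proof.
exists (fun a => (a, fun=> 0)) => [[a c]|a]; rewrite big_ord0 cr_addr0 //.
by congr pair; apply: functional_extensionality => -[].
Qed.

Lemma ground_nilpotent : exists k : nat, forall u : 'I_k -> R,
  (forall i, u i = 0) -> \cprod_(i < k) u i = 0.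
Proof. by exists 1%N => u u0; rewrite big_ord1. Qed.

Definition ground : weil_algebra R :=
  @WeilAlgebra R R id id 0 _ (ring_hom_id R) (ring_hom_id R)
    (fun=> erefl) (fun=> erefl) ground_basisP ground_nilpotent.

Lemma sqzero_nil (A : cring) : exists m, cr_exp (cr0 A) m = cr0 A.
Proof. by exists 1%N; apply: cr_mul0. Qed.

Lemma delta_free k : bijective (fun c : 'I_k -> R =>
  \big[@cr_add (fun_ring R k)/cr0 (fun_ring R k)]_(i < k)
     cr_mul ((fun=> c i) : fun_ring R k) (delta i)).
Proof.
have E (c : 'I_k -> R) : \big[@cr_add (fun_ring R k)/cr0 (fun_ring R k)]_(i < k)
     cr_mul ((fun=> c i) : fun_ring R k) (delta i) = c.
  apply: functional_extensionality => j.
  rewrite (big_morph (fun u : fun_ring R k => u j)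
             (id1 := cr0 R) (op1 := @cr_add R)) //.
  exact: sum_delta.
by exists id => c; rewrite E.
Qed.

(** The coordinate ring R + R^k, with R^k of square zero, of D(k). *)
Definition axes k : weil_algebra R :=
  @weil_ext R ground (fun_ring R k) _ (const_hom R k) _ (sqzero_nil _) k
    _ (delta_free k).

(** The algebra W[eps] with eps^2 = 0, whose spectrum is D x Spec W. *)
Definition dual (W : weil_algebra R) : weil_algebra R :=
  @weil_ext R W W id (ring_hom_id W) _ (sqzero_nil W) _ _ (full_basis_free W).

Record pointed_weil := PointedWeil {
  pw_alg :> weil_algebra R;
  pw_pt : pw_alg;
  pw_nil : exists m, cr_exp pw_pt m = cr0 pw_alg }.

Section Shift.
Variable P : pointed_weil.

Definition shift_alg : weil_algebra R :=
  @weil_ext R ground P _ (wa_scal_hom P) _ (pw_nil P) _ _ (full_basis_free P).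

Definition shift_pt : shift_alg := (0, cr1 P).

Lemma shift_pt_exp m : cr_exp shift_pt m.+1 = (0, cr_exp (pw_pt P) m).
Proof.
elim: m => [|m IH]; first exact: cr_mulr1.
rewrite /cr_exp iterS -/(cr_exp _ m.+1) IH.
apply: etrans (ext_inr_mul (wa_scal_hom P) _ _ _) _.
by rewrite cr_mul1.
Qed.

Lemma shift_nil : exists m, cr_exp shift_pt m = cr0 shift_alg.
Proof.
by have [m xm] := pw_nil P; exists m.+1; rewrite shift_pt_exp xm.
Qed.

Definition shift := PointedWeil shift_nil.

End Shift.

(** The algebra R[x]/x^(n+1), built as R + x R[x]/x^n, together with the class
    of x. *)
Fixpoint trunc n : pointed_weil :=
  if n is n'.+1 then shift (trunc n')
  else @PointedWeil ground 0 (sqzero_nil R).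

Lemma trunc_dim n : wa_dim (trunc n) = n.
Proof. by elim: n => //= n ->. Qed.

Lemma trunc_pt_exp n : cr_exp (pw_pt (trunc n)) n.+1 = cr0 (trunc n).
Proof.
elim: n => [|n IH]; first exact: cr_mul0.
by rewrite [LHS](shift_pt_exp (trunc n)) IH.
Qed.

Lemma trunc_basis n i :
  full_basis (W := trunc n) i = cr_exp (pw_pt (trunc n)) i.
Proof.
elim: n i => [|n IH] i; first by rewrite [i]ord1 full_basis0.
case: (unliftP ord0 i) => [j|] ->; last exact: full_basis0.
rewrite full_basis_lift lift0 [RHS](shift_pt_exp (trunc n)) -IH.
by rewrite /= /wext_basis; case: splitP => [[]//|k /= e]; congr (0, full_basis _);
  apply: val_inj.
Qed.

Section TruncEval.
Variable d : R.

(** Horner's scheme for the value at d. *)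
Fixpoint trunc_eval n : trunc n -> R :=
  match n return trunc n -> R with
  | O => id
  | n'.+1 => fun p => p.1 + d * trunc_eval p.2
  end.

Lemma trunc_evalD n (u v : trunc n) :
  trunc_eval (cr_add u v) = trunc_eval u + trunc_eval v.
Proof.
elim: n u v => [//|n IH] [a u] [b v] /=; rewrite IH.
have E (s t s' t' : R) : s + t + d * (s' + t') = s + d * s' + (t + d * t').
  by ring.
exact: E.
Qed.

Lemma trunc_eval_scal n a : trunc_eval (wa_scal (trunc n) a) = a.
Proof.
case: n a => //= n a.
have -> : trunc_eval (cr0 (trunc n)) = 0.
  apply: (@cr_addI _ (trunc_eval (cr0 (trunc n)))).
  by rewrite -trunc_evalD !cr_addr0.
by rewrite cr_mulr0 cr_addr0.
Qed.

(** Evaluation is multiplicative only up to a multiple of d^(n+1).  The factor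
    c absorbs the defect and makes the induction go through: one step down
    in n, it becomes c d. *)
Lemma trunc_eval_pt n (c : R) (u : trunc n) : c * d ^+ n.+1 = 0 ->
  c * trunc_eval (cr_mul (pw_pt (trunc n)) u) = c * (d * trunc_eval u).
Proof.
elim: n c u => [|n IH] c u cd /=.
  move: cd => /=; rewrite cr_mulr1 cr_mul0 cr_mulr0 cr_mulA => ->.
  by rewrite cr_mul0.
have cd' : c * d * d ^+ n.+1 = 0 by rewrite -cr_mulA.
rewrite (rh0 (wa_scal_hom (trunc n))) !cr_mul0 !cr_add0 cr_mulr1 cr_mul1.
rewrite trunc_evalD trunc_eval_scal !cr_mulDr cr_mulA; congr cr_add.
by rewrite cr_mulA IH // !cr_mulA.
Qed.

Lemma trunc_evalM n (c : R) (u v : trunc n) : c * d ^+ n.+1 = 0 ->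
  c * trunc_eval (cr_mul u v) = c * (trunc_eval u * trunc_eval v).
Proof.
elim: n c u v => [//|n IH] c u v cd /=.
have cd' : c * d * d ^+ n.+1 = 0 by rewrite -cr_mulA.
rewrite !trunc_evalD.
have -> (a b e f : R) : c * (a + d * (b + e + f)) =
    c * a + (c * d * b + c * d * e + c * d * f) by ring.
rewrite trunc_eval_pt //.
have -> (a b : R) : c * d * (a * b) = a * (c * d * b) by ring.
rewrite !IH // !trunc_eval_scal.
have E (s t s' t' : R) : c * (s * t) + (c * d * (s * t') + c * d * (t * s')
  + d * (c * d * (s' * t'))) = c * ((s + d * s') * (t + d * t')) by ring.
exact: E.
Qed.

End TruncEval.

Lemma trunc_eval_hom n (d : D R n) : ring_hom (@trunc_eval (sval d) n).
Proof.
split; last first.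
- move=> u v; have := @trunc_evalM (sval d) n 1 u v.
  by rewrite !cr_mul1; apply; case: d.
- exact: trunc_evalD.
- by rewrite -(rh1 (wa_scal_hom (trunc n))) trunc_eval_scal.
Qed.

Definition trunc_spec n (d : D R n) : Spec (trunc n) :=
  exist _ _ (conj (trunc_eval_hom d) (@trunc_eval_scal (sval d) n)).

Lemma trunc_spec_pt n (d : D R n) : sval (trunc_spec d) (pw_pt (trunc n)) = sval d.
Proof.
have := @trunc_eval_pt (sval d) n 1 (cr1 _).
rewrite !cr_mul1 (rh1 (trunc_eval_hom d)) !cr_mulr1; apply.
by case: d.
Qed.

Lemma spec_pt_nil n (phi : Spec (trunc n)) :
  sval phi (pw_pt (trunc n)) ^+ n.+1 = 0.
Proof.
by have [phiH _] := svalP phi; rewrite -(rh_exp phiH) trunc_pt_exp (rh0 phiH).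
Qed.

Definition spec_pt n (phi : Spec (trunc n)) : D R n :=
  exist _ _ (spec_pt_nil phi).

End Instances.

(** * Diagrams of spectra *)

Section Spec.
Variable R : cring.

Definition alg_hom (V W : weil_algebra R) : Type :=
  {h : V -> W | ring_hom h /\ forall a, h (wa_scal V a) = wa_scal W a}.

Lemma spec_map_subproof (V W : weil_algebra R) (h : alg_hom V W) (phi : Spec W) :
  ring_hom (sval phi \o sval h) /\ forall a, sval phi (sval h (wa_scal V a)) = a.
Proof.
case: h phi => h [hH hS] [phi [phiH phiS]] /=; split=> [|a].
  exact: ring_hom_comp.
by rewrite hS phiS.
Qed.

Definition spec_map (V W : weil_algebra R) (h : alg_hom V W) (phi : Spec W) :
  Spec V := exist _ _ (spec_map_subproof h phi).

Lemma spec_eq (W : weil_algebra R) (phi psi : Spec W) :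
  sval phi =1 sval psi -> phi = psi.
Proof. by move=> e; apply: sval_eq; apply: functional_extensionality. Qed.

(** A diagram of Weil algebras with a cone, indexed by the diagram of spectra
    that it induces: an edge from v to w of spaces is a homomorphism from the
    algebra of w to that of v. *)
Record alg_cone := AlgCone {
  ac_vert : finType;
  ac_edge : finType;
  ac_src : ac_edge -> ac_vert;
  ac_tgt : ac_edge -> ac_vert;
  ac_obj : ac_vert -> weil_algebra R;
  ac_map : forall e, alg_hom (ac_obj (ac_tgt e)) (ac_obj (ac_src e));
  ac_apex : weil_algebra R;
  ac_leg : forall v, alg_hom ac_apex (ac_obj v);
  ac_comm : forall e w,
    sval (ac_map e) (sval (ac_leg (ac_tgt e)) w) = sval (ac_leg (ac_src e)) w }.

Arguments ac_src : clear implicits.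
Arguments ac_tgt : clear implicits.
Arguments ac_obj : clear implicits.
Arguments ac_map : clear implicits.
Arguments ac_leg : clear implicits.

Lemma spec_cocone_comm (C : alg_cone) e (phi : Spec (ac_obj C (ac_src C e))) :
  spec_map (ac_leg C (ac_tgt C e)) (spec_map (ac_map C e) phi)
  = spec_map (ac_leg C (ac_src C e)) phi.
Proof. by apply: spec_eq => w /=; rewrite ac_comm. Qed.

Definition spec_cocone (C : alg_cone) : inf_cocone R :=
  @InfCocone R _ _ _ _ _ (fun e => spec_map (ac_map C e)) _
    (fun v => spec_map (ac_leg C v)) (@spec_cocone_comm C).

Lemma lim_pow_eq (M : Type) (C : inf_cocone R) (h h' : lim_pow M C) :
  (forall v x, sval h v x = sval h' v x) -> h = h'.
Proof.
move=> e; apply: sval_eq; apply: functional_extensionality_dep => v.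
exact: functional_extensionality.
Qed.

(** How microlinearity is used to prove equations: functions on the apex agree
    as soon as they agree along all legs. *)
Lemma pow_cone_inj (M : Type) (C : inf_cocone R) (f f' : Spec (ic_apex C) -> M) :
  sends_to_limit M C ->
  (forall v x, f (ic_leg C v x) = f' (ic_leg C v x)) -> f =1 f'.
Proof.
move=> /bij_inj inj e x; congr (_ x).
by apply: inj; apply: lim_pow_eq => v y; apply: e.
Qed.

(** By the Kock-Lawvere axiom, functions from a spectrum into the line are the
    elements of the algebra, so that a limit cone of Weil algebras gives a
    colimit of spectra from the point of view of the line. *)
Lemma spec_cocone_limit (C : alg_cone) : kock_lawvere R ->
  (exists lift : (forall v, ac_obj C v) -> ac_apex C,
     (forall a, lift (fun v => sval (ac_leg C v) a) = a) /\
     (forall w, (forall e, sval (ac_map C e) (w (ac_tgt C e)) = w (ac_src C e)) ->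
        forall v, sval (ac_leg C v) (lift w) = w v)) ->
  sends_to_limit R (spec_cocone C).
Proof.
move=> KL [lift [liftK Klift]].
pose ev (W : weil_algebra R) (w : W) (phi : Spec W) := sval phi w.
have [inv invP] : exists inv : forall v, (Spec (ac_obj C v) -> R) -> ac_obj C v,
    forall v, cancel (@ev _) (inv v) /\ cancel (inv v) (@ev _).
  apply: (finite_choice
    (P := fun v i => cancel (@ev (ac_obj C v)) i /\ cancel i (@ev _))) => v.
  by case: (KL (ac_obj C v)) => i iK Ki; exists i.
exists (fun h chi => sval chi (lift (fun v => inv v (sval h v)))) => [f|h].
- case: (KL (ac_apex C)) => i _ Ki.
  rewrite -(Ki f); apply: functional_extensionality => chi; congr (sval chi _).
  rewrite -[RHS]liftK; congr lift; apply: functional_extensionality_dep => v.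
  exact: (invP v).1.
- have hC : forall (e : ac_edge C) (psi : Spec (ac_obj C (ac_src C e))),
      sval h (ac_tgt C e) (spec_map (ac_map C e) psi) = sval h (ac_src C e) psi.
    exact: (svalP h).
  have evK v phi : sval phi (inv v (sval h v)) = sval h v phi.
    by have /(congr1 (fun f => f phi)) := (invP v).2 (sval h v).
  apply: lim_pow_eq => v phi /=; rewrite Klift ?evK // => e.
  apply: (can_inj (invP _).1); apply: functional_extensionality => psi.
  by rewrite /ev evK -hC -evK.
Qed.

End Spec.

(** * Two colimits seen by the line *)

Section Cones.
Variable R : cring.
Hypothesis KL : kock_lawvere R.
Local Open Scope cr_scope.
Add Ring C_R : (cr_theory R).

Section AxesCone.
Variable k : nat.

Lemma axes_fst_subproof : ring_hom (fst : axes R k -> ground R) /\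
  forall a, fst (wa_scal (axes R k) a) = wa_scal (ground R) a.
Proof. by []. Qed.
Definition axes_fst : alg_hom (axes R k) (ground R) :=
  exist _ _ axes_fst_subproof.

Lemma axes_proj_subproof (i : 'I_k) :
  ring_hom (fun p : axes R k => (p.1, p.2 i) : dual (ground R)) /\
  forall a, (a, 0) = wa_scal (dual (ground R)) a.
Proof. by []. Qed.
Definition axes_proj i : alg_hom (axes R k) (dual (ground R)) :=
  exist _ _ (axes_proj_subproof i).

End AxesCone.

Lemma dual_fst_subproof (W : weil_algebra R) : ring_hom (fst : dual W -> W) /\
  forall a, fst (wa_scal (dual W) a) = wa_scal W a.
Proof. by []. Qed.
Definition dual_fst W : alg_hom (dual W) W := exist _ _ (dual_fst_subproof W).

Lemma scal_subproof (W : weil_algebra R) : ring_hom (wa_scal W : ground R -> W) /\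
  forall a, wa_scal W (wa_scal (ground R) a) = wa_scal W a.
Proof. by split=> //; apply: wa_scal_hom. Qed.
Definition scal_alg_hom W : alg_hom (ground R) W := exist _ _ (scal_subproof W).

(** The diagram of k copies of D, with their origins glued to one point [None]. *)
Definition axes_obj k (v : option 'I_k) : weil_algebra R :=
  if v is Some _ then dual (ground R) else ground R.

Definition axes_leg k (v : option 'I_k) : alg_hom (axes R k) (axes_obj v) :=
  match v with Some i => axes_proj i | None => axes_fst k end.

Definition axes_cone k : alg_cone R :=
  @AlgCone R (option 'I_k) 'I_k (fun=> None) Some (@axes_obj k)
    (fun=> dual_fst (ground R)) (axes R k) (@axes_leg k) (fun _ _ => erefl).

Lemma axes_cone_limit k : sends_to_limit R (spec_cocone (axes_cone k)).
Proof.
apply: spec_cocone_limit => //.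
exists (fun w : forall v : option 'I_k, axes_obj v =>
  ((w None : R), fun i => (w (Some i) : R * R).2)).
split=> [[a u]//|w wP].
by case=> [i|] //=; rewrite -(wP i) -surjective_pairing.
Qed.

Variable W : weil_algebra R.

(** The pushout of the point and of D x Spec W ([Some true]) along Spec W
    ([Some false]), embedded as {0} x Spec W. *)
Definition cyl_obj (v : option bool) : weil_algebra R :=
  match v with None => ground R | Some false => W | Some true => dual W end.

Definition cyl_tgt (e : bool) : option bool := if e then Some true else None.

Definition cyl_map (e : bool) : alg_hom (cyl_obj (cyl_tgt e)) (cyl_obj (Some false)) :=
  match e with true => dual_fst W | false => scal_alg_hom W end.

Lemma axes_scal_subproof k :
  ring_hom (fun p : axes R k => wa_scal W p.1) /\
  forall a, wa_scal W (wa_scal (axes R k) a).1 = wa_scal W a.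
Proof.
split=> //; exact: (ring_hom_comp (wa_scal_hom W) (axes_fst_subproof k).1).
Qed.
Definition axes_scal k : alg_hom (axes R k) W :=
  exist _ _ (axes_scal_subproof k).

Lemma lin_combD c c' :
  lin_comb (W := W) (fun i => c i + c' i) = lin_comb c + lin_comb c'.
Proof.
rewrite /lin_comb -big_split; apply: eq_bigr => i _ /=.
by rewrite (rhD (wa_scal_hom W)) cr_mulC cr_mulDr !(cr_mulC (full_basis _)).
Qed.

Lemma lin_combZ a c :
  lin_comb (W := W) (fun i => a * c i) = wa_scal W a * lin_comb c.
Proof.
rewrite /lin_comb (big_morph _ (cr_mulDr _) (cr_mulr0 _)).
by apply: eq_bigr => i _; rewrite (rhM (wa_scal_hom W)) cr_mulA.
Qed.

Let AW := axes R (wa_dim W).+1.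

(** The coordinate form of (d, phi) |-> (d phi(b_0), .., d phi(b_m)): the i-th
    coordinate function of D(k) is sent to eps b_i. *)
Lemma axes_lin_subproof :
  ring_hom (fun p : AW => (wa_scal W p.1, lin_comb p.2) : dual W) /\
  forall a, (wa_scal W (wa_scal AW a).1, lin_comb (wa_scal AW a).2)
    = wa_scal (dual W) a.
Proof.
have WH := wa_scal_hom W.
have lin0 : lin_comb (W := W) (fun=> 0) = 0.
  by apply: big1 => i _; rewrite (rh0 WH) cr_mul0.
split=> [|a]; last by congr pair; apply: lin0.
split=> [|[a u] [b v]|[a u] [b v]]; congr pair => /=.
- exact: rh1.
- exact: lin0.
- exact: rhD.
- exact: lin_combD.
- exact: rhM.
- rewrite -!lin_combZ cr_mul0 cr_addr0 -lin_combD; congr lin_comb.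
  by apply: functional_extensionality => i; ring.
Qed.

Definition axes_lin : alg_hom AW (dual W) :=
  exist _ _ axes_lin_subproof.

Definition cyl_leg (v : option bool) : alg_hom (axes R (wa_dim W).+1) (cyl_obj v) :=
  match v with
  | None => axes_fst _
  | Some false => axes_scal _
  | Some true => axes_lin
  end.

Lemma cyl_comm e w : sval (cyl_map e) (sval (cyl_leg (cyl_tgt e)) w)
  = sval (cyl_leg (Some false)) w.
Proof. by case: e. Qed.

Definition cyl_cone : alg_cone R := AlgCone cyl_comm.

(** A pair (u, v) in W[eps] is constant on {0} x Spec W when u is a scalar; so
    the limit is R + W, and the basis identifies it with R + R^k. *)
Lemma cyl_cone_limit : sends_to_limit R (spec_cocone cyl_cone).
Proof.
apply: spec_cocone_limit => //; case: (full_basis_free W) => g gK Kg.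
exists (fun w : forall v, cyl_obj v =>
  ((w None : R), g (w (Some true) : W * W).2)).
split=> [[a u]|w wP].
  by congr pair; apply: gK.
have := wP false; have := wP true => /= wt wf.
case=> [[]|] //=; rewrite wf // Kg -wt; exact: esym (surjective_pairing _).
Qed.

End Cones.

(** * Equations in modules *)

Section ModuleRing.
Variables (R : cring) (E : rmodule R).
Local Open Scope sdg_scope.

Lemma md_addr0 (x : E) : x + md0 E = x.
Proof. by rewrite md_addC md_add0. Qed.

Lemma md_addrN (x : E) : x - x = md0 E.
Proof. by rewrite md_addC md_addN. Qed.

Lemma md_addI (x y z : E) : x + y = x + z -> y = z.
Proof.
by move=> h; rewrite -(md_add0 y) -(md_addN x) -md_addA h md_addA md_addN md_add0.
Qed.

Lemma md_scale0l (x : E) : cr0 R *: x = md0 E.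
Proof.
by apply: (@md_addI (cr0 R *: x)); rewrite -md_scaleDl cr_addr0 md_addr0.
Qed.

Lemma md_scaler0 (a : R) : a *: md0 E = md0 E.
Proof. by apply: (@md_addI (a *: md0 E)); rewrite -md_scaleDr !md_addr0. Qed.

Lemma md_addCA (x y z : E) : x + (y + z) = y + (x + z).
Proof. by rewrite !md_addA (md_addC x). Qed.

(** The ring R + E in which E has square zero.  An R-linear identity in E is
    an identity between elements of this commutative ring, and thereby becomes
    accessible to ring normalization. *)
Definition mr_mul (p q : R * E) : R * E :=
  (cr_mul p.1 q.1, p.1 *: q.2 + q.1 *: p.2).

Lemma mr_theory : @ring_theory (R * E) (cr0 R, md0 E) (cr1 R, md0 E)
  (fun p q => (cr_add p.1 q.1, p.2 + q.2)) mr_mul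
  (fun p q => (cr_add p.1 (cr_opp q.1), p.2 - q.2))
  (fun p => (cr_opp p.1, - p.2)) eq.
Proof.
have RT := cr_theory R.
split=> [[a u]|[a u] [b v]|[a u] [b v] [c w]|[a u]|[a u] [b v]
       |[a u] [b v] [c w]|[a u] [b v] [c w]|[a u] [b v]|[a u]];
  rewrite /mr_mul /=; congr pair.
- exact: cr_add0.
- exact: md_add0.
- exact: cr_addC.
- exact: md_addC.
- exact: cr_addA.
- exact: md_addA.
- exact: cr_mul1.
- by rewrite md_scale1 md_scaler0 md_addr0.
- exact: cr_mulC.
- exact: md_addC.
- exact: cr_mulA.
- rewrite !md_scaleDr !md_scaleA !md_addA !(cr_mulC c).
  by rewrite (cr_mulC b).
- exact: Rdistr_l RT _ _ _.
- rewrite md_scaleDl md_scaleDr -!md_addA; congr md_add.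
  exact: md_addCA.
- exact: Ropp_def RT _.
- exact: md_addrN.
Qed.

Definition mod_ring : cring :=
  @CRing (R * E) _ _ _ _ (fun p => (cr_opp p.1, - p.2)) mr_theory.

Definition emb (x : E) : mod_ring := (cr0 R, x).
Definition sca (a : R) : mod_ring := (a, md0 E).

Lemma emb_inj : injective emb. Proof. by move=> x y []. Qed.

Lemma embD x y : emb (x + y) = cr_add (emb x) (emb y).
Proof. by congr pair => /=; rewrite cr_add0. Qed.

Lemma embN x : emb (- x) = cr_opp (emb x).
Proof.
by congr pair => /=; rewrite -[RHS]cr_add0 (Ropp_def (cr_theory R)).
Qed.

Lemma emb0 : emb (md0 E) = cr0 mod_ring. Proof. by []. Qed.

Lemma embZ a x : emb (a *: x) = cr_mul (sca a) (emb x).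
Proof. by congr pair => /=; rewrite ?md_scale0l ?md_addr0 // cr_mulr0. Qed.

Lemma scaD a b : sca (cr_add a b) = cr_add (sca a) (sca b).
Proof. by congr pair => /=; rewrite md_add0. Qed.

Definition embE := (embD, embN, emb0, embZ, scaD).

End ModuleRing.

HB.instance Definition _ (R : cring) (E : rmodule R) :=
  Monoid.isComLaw.Build E (md0 E) (@md_add R E)
    (@md_addA R E) (@md_addC R E) (@md_add0 R E).

Notation "\msum_ ( i < n ) F" := (\big[@md_add _ _/md0 _]_(i < n) F)
  (at level 41, i, n at level 50, F at level 41,
   format "\msum_ ( i  <  n )  F") : sdg_scope.

(** * The Kock-Lawvere property of Euclidean microlinear modules *)

Section VectorKL.
Variables (R : cring) (KL : kock_lawvere R) (E : rmodule R).
Hypotheses (E_eucl : euclidean E) (E_micro : microlinear R E).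
Local Open Scope sdg_scope.

Lemma msum_scale n a (F : 'I_n -> E) :
  a *: (\msum_(i < n) F i) = \msum_(i < n) (a *: F i).
Proof. exact: (big_morph _ (md_scaleDr a) (md_scaler0 E a)). Qed.

Lemma euclidean_cancel (x y : E) :
  (forall d : D R 1, sval d *: x = sval d *: y) -> x = y.
Proof.
case: E_eucl => deriv derivP exy.
have dP z : deriv (fun d => sval d *: z) = z.
  by apply: (derivP _).2 => d /=; rewrite md_scale0l md_add0.
by rewrite -(dP x) -(dP y); congr deriv; apply: functional_extensionality.
Qed.

Lemma sq0 (d : D R 1) : cr_mul (sval d) (sval d) = cr0 R.
Proof. by have := svalP d; rewrite /cr_exp /= cr_mulr1. Qed.

Section Dual.
Variable W : weil_algebra R.

Add Ring VK_R : (cr_theory R).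

Definition dual_eps : dual W := (cr0 W, cr1 W).

Lemma dual_spec_subproof (phi : Spec W) (d : D R 1) :
  ring_hom (fun p : dual W =>
    cr_add (sval phi p.1) (cr_mul (sval d) (sval phi p.2))) /\
  forall a, cr_add (sval phi (wa_scal W a)) (cr_mul (sval d) (sval phi (cr0 W)))
     = a.
Proof.
have [phiH phiS] := svalP phi.
split=> [|a]; last by rewrite phiS (rh0 phiH); ring.
split=> [|[a u] [b v]|[a u] [b v]] /=.
- by rewrite (rh1 phiH) (rh0 phiH); ring.
- by rewrite !(rhD phiH); ring.
- rewrite !(rhD phiH) !(rhM phiH) (rh0 phiH).
  (* The failure of multiplicativity is a multiple of d^2. *)
  have E' (a' b' u' v' e : R) : cr_add (cr_mul a' b') (cr_mul e (cr_add
    (cr_add (cr_mul a' v') (cr_mul b' u')) (cr_mul (cr0 R) (cr_mul u' v')))) =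
    cr_add (cr_mul (cr_add a' (cr_mul e u')) (cr_add b' (cr_mul e v')))
      (cr_opp (cr_mul (cr_mul e e) (cr_mul u' v'))) by ring.
  rewrite E' (sq0 d); ring.
Qed.

Definition dual_spec phi d : Spec (dual W) := exist _ _ (dual_spec_subproof phi d).

Lemma dual_inl_subproof : ring_hom (fun w : W => (w, cr0 W) : dual W) /\
  forall a, (wa_scal W a, cr0 W) = wa_scal (dual W) a.
Proof. by split=> //; exact: (ext_inl_hom (ring_hom_id W) (cr0 W)). Qed.
Definition dual_inl : alg_hom W (dual W) := exist _ _ dual_inl_subproof.

End Dual.

Definition ground_spec : Spec (ground R) :=
  exist _ _ (conj (ring_hom_id R) (fun=> erefl)).

Lemma ground_spec_eq (phi : Spec (ground R)) : phi = ground_spec.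
Proof. by apply: spec_eq => w /=; apply: (svalP phi).2. Qed.

Lemma dual_eps_sq (W : weil_algebra R) :
  cr_mul (dual_eps W) (dual_eps W) = cr0 (dual W).
Proof. by rewrite [LHS](ext_inr_mul (ring_hom_id W)) cr_mul0. Qed.

Lemma spec_eps_nil (phi : Spec (dual (ground R))) :
  cr_exp (sval phi (dual_eps _)) 2 = cr0 R.
Proof.
have [phiH _] := svalP phi.
by rewrite /cr_exp /= cr_mulr1 -(rhM phiH) dual_eps_sq (rh0 phiH).
Qed.

Definition spec_eps (phi : Spec (dual (ground R))) : D R 1 :=
  exist _ _ (spec_eps_nil phi).

(** The spectrum of R[eps] is D. *)
Lemma spec_epsK phi : dual_spec ground_spec (spec_eps phi) = phi.
Proof.
apply: spec_eq => -[a u] /=; have [phiH phiS] := svalP phi.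
have -> : ((a, u) : dual (ground R)) = cr_add (wa_scal (dual (ground R)) a)
    (cr_mul (wa_scal (dual (ground R)) u) (dual_eps _)).
  by congr pair; rewrite /= !(cr_mulr0, cr_mul0, cr_mulr1, cr_addr0, cr_add0).
by rewrite (rhD phiH) (rhM phiH) !phiS (cr_mulC u).
Qed.

Section Axes.
Variable k : nat.

Definition axes_unit (i : 'I_k) : axes R k := (cr0 R, delta i).

Definition axes_lin_fun (X : 'I_k -> E) (chi : Spec (axes R k)) : E :=
  \msum_(i < k) (sval chi (axes_unit i) *: X i).

Definition axis (i : 'I_k) (d : D R 1) : Spec (axes R k) :=
  spec_map (axes_proj R i) (dual_spec ground_spec d).

Lemma axes_lin_fun_axis X i d : axes_lin_fun X (axis i d) = sval d *: X i.
Proof.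
rewrite /axes_lin_fun (bigD1 i) //= big1 => [|j /negbTE ji].
  by rewrite md_addr0 /delta eqxx cr_add0 cr_mulr1.
by rewrite /delta ji cr_add0 cr_mulr0 md_scale0l.
Qed.

Definition base_pt : Spec (axes R k) := spec_map (axes_fst R k) ground_spec.

Lemma axis0 i : axis i (D0 R 1) = base_pt.
Proof. by apply: spec_eq => -[a u] /=; rewrite cr_mul0 cr_addr0. Qed.

Lemma axes_lin_fun_base X : axes_lin_fun X base_pt = md0 E.
Proof. by apply: big1 => i _; exact: md_scale0l. Qed.

(** D(k) is the union of its axes for functions into E. *)
Lemma axes_linear (F : Spec (axes R k) -> E) (X : 'I_k -> E) :
  F base_pt = md0 E ->
  (forall i d, F (axis i d) = sval d *: X i) -> F =1 axes_lin_fun X.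
Proof.
move=> F0 FX.
apply: (pow_cone_inj (C := spec_cocone (axes_cone R k)) (E_micro (axes_cone_limit KL k))).
case=> [i|] x /=.
  by rewrite -(spec_epsK x) -/(axis i _) FX axes_lin_fun_axis.
by rewrite (ground_spec_eq x) -/base_pt F0 axes_lin_fun_base.
Qed.

End Axes.

Variable W : weil_algebra R.
Local Notation k := (wa_dim W).+1.
Local Notation C := (spec_cocone (cyl_cone W)).

Definition cyl_fun (f : Spec W -> E) (psi : Spec (dual W)) : E :=
  sval psi (dual_eps W) *: f (spec_map (dual_inl W) psi).

Definition cyl_family (f : Spec W -> E) (v : option bool) : Spec (cyl_obj W v) -> E :=
  match v with Some true => cyl_fun f | _ => fun=> md0 E end.

(** (d, phi) |-> d f(phi) vanishes on {0} x Spec W, which makes it, with the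
    zero function at the other vertices, a compatible family. *)
Lemma cyl_family_comm f (e : bool) (x : Spec W) :
  cyl_family f (spec_map (cyl_map W e) x) = md0 E.
Proof.
case: e x => //= x; rewrite /cyl_fun /= (rh0 (svalP x).1); exact: md_scale0l.
Qed.

Definition cyl_lim f : lim_pow E C := exist _ (@cyl_family f) (cyl_family_comm f).

Definition vec_comb (X : 'I_k -> E) (phi : Spec W) : E :=
  \msum_(i < k) (sval phi (full_basis i) *: X i).

Lemma axes_lin_unit i :
  sval (axes_lin W) (axes_unit i) = cr_mul (dual_eps W) (full_basis i, cr0 W).
Proof.
congr pair; rewrite /= ?(rh0 (wa_scal_hom W)).
  by rewrite cr_mul0.
rewrite !(cr_mulr0, cr_mul0, cr_mulr1, cr_addr0, cr_add0).
rewrite /lin_comb (bigD1 i) //= /delta eqxx (rh1 (wa_scal_hom W)) cr_mul1.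
rewrite big1 ?cr_addr0 // => j; rewrite eq_sym => /negbTE ->.
by rewrite (rh0 (wa_scal_hom W)) cr_mul0.
Qed.

Lemma cyl_fun_vec X (psi : Spec (dual W)) :
  cyl_fun (vec_comb X) psi = axes_lin_fun X (spec_map (axes_lin W) psi).
Proof.
rewrite /cyl_fun /vec_comb msum_scale; apply: eq_bigr => i _.
by rewrite md_scaleA -(rhM (svalP psi).1) -axes_lin_unit.
Qed.

Lemma cyl_lim_vec X : cyl_lim (vec_comb X) = pow_cone (C := C) (axes_lin_fun X).
Proof.
apply: lim_pow_eq => -[[]|] x /=; first exact: cyl_fun_vec.
- rewrite [RHS]big1 // => i _; rewrite /= (rh0 (wa_scal_hom W)) (rh0 (svalP x).1).
  exact: md_scale0l.
- by rewrite (ground_spec_eq x) [RHS]axes_lin_fun_base.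
Qed.

(** The coefficients of f are the slopes along the axes of the function on
    D(k) through which (d, phi) |-> d f(phi) factors. *)
Theorem vector_kock_lawvere : bijective vec_comb.
Proof.
case: (E_micro (cyl_cone_limit KL W)) => G GK KG; case: (E_eucl) => deriv derivP.
exists (fun f i => deriv (fun d => G (cyl_lim f) (axis i d))) => [X|f].
  apply: functional_extensionality => i; rewrite cyl_lim_vec GK.
  apply: (derivP _).2 => d.
  by rewrite !axes_lin_fun_axis /= md_scale0l md_add0.
set X := fun i => _.
have legE v (x : Spec (cyl_obj W v)) :
    G (cyl_lim f) (spec_map (cyl_leg W v) x) = cyl_family f x.
  by have /(congr1 (fun h => sval h v x)) := KG (cyl_lim f).
have F0 : G (cyl_lim f) (base_pt _) = md0 E by exact: (legE None).
have FX : G (cyl_lim f) =1 axes_lin_fun X.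
  apply: axes_linear => // i d.
  by rewrite ((derivP (fun d => G (cyl_lim f) (axis i d))).1 d) axis0 F0 md_add0.
apply: functional_extensionality => phi; apply: euclidean_cancel => d.
have /= := legE (Some true) (dual_spec phi d).
rewrite FX -[axes_lin_fun _ _]cyl_fun_vec /cyl_fun /=.
rewrite (rh0 (svalP phi).1) (rh1 (svalP phi).1) cr_add0 cr_mulr1.
suff -> : spec_map (dual_inl W) (dual_spec phi d) = phi by [].
by apply: spec_eq => w /=; rewrite (rh0 (svalP phi).1) cr_mulr0 cr_addr0.
Qed.

End VectorKL.

(** * Taylor expansion and coordinates of jets *)

Section Taylor.
Variables (R : cring) (KL : kock_lawvere R) (E : rmodule R).
Hypotheses (E_eucl : euclidean E) (E_micro : microlinear R E).
Local Open Scope sdg_scope.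

Lemma trunc_specK n : cancel (@trunc_spec R n) (@spec_pt R n).
Proof. by move=> d; apply: sval_eq; apply: trunc_spec_pt. Qed.

(** The powers of x form a basis of R[x]/x^(n+1), and D_n is a retract of its
    spectrum, which suffices to transport the bijection. *)
Theorem taylor n : bijective (fun (X : 'I_n.+1 -> E) (d : D R n) =>
  \msum_(i < n.+1) (cr_exp (sval d) i *: X i)).
Proof.
suff: bijective (fun (X : 'I_(wa_dim (trunc R n)).+1 -> E) (d : D R n) =>
    \msum_(i < (wa_dim (trunc R n)).+1) (cr_exp (sval d) i *: X i)).
  by move: (wa_dim _) (trunc_dim R n) => m ->.
have E_vec X phi : vec_comb (W := trunc R n) X phi =
    \msum_(i < (wa_dim (trunc R n)).+1)
      (cr_exp (sval (spec_pt phi)) i *: X i).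
  by apply: eq_bigr => i _; rewrite trunc_basis (rh_exp (svalP phi).1).
case: (vector_kock_lawvere KL E_eucl E_micro (trunc R n)) => g gK Kg.
exists (fun f => g (f \o @spec_pt R n)) => [X|f].
  rewrite -[RHS]gK; congr g; apply: functional_extensionality => phi.
  by rewrite E_vec.
apply: functional_extensionality => d.
by rewrite -{1}(trunc_specK d) -E_vec Kg /= trunc_specK.
Qed.

End Taylor.

Section JetCoordinates.
Variables (L : line) (g : lie_algebra L).
Local Open Scope sdg_scope.

(** Vanishing at 0 kills the coefficient of degree 0, so that a jet has exactly
    n coordinates.  They are indexed by nat so that they can be read off an
    explicit list, and shifted: index i carries degree i + 1. *)
Lemma jet_coords n : exists T : jets g n -> nat -> g,
  (forall f d, sval f d = \msum_(i < n) (cr_exp (sval d) i.+1 *: T f i)) /\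
  (forall (f : jets g n) (X : nat -> g),
     (forall d, sval f d = \msum_(i < n) (cr_exp (sval d) i.+1 *: X i)) ->
     forall i, (i < n)%N -> T f i = X i).
Proof.
case: (taylor (@line_kl L) (@la_euclidean L g) (@la_microlinear L g) n) => G GK KG.
exists (fun f i => G (sval f) (inord i.+1)); split=> [f d|f X fX i lin].
  have fE e : sval f e =
      \msum_(i < n.+1) (cr_exp (sval e) i *: G (sval f) i) by rewrite -{1}(KG (sval f)).
  have G0 : G (sval f) ord0 = md0 g.
    apply: etrans _ (svalP f); rewrite fE big_ord_recl md_scale1 big1 ?md_addr0 // => i _.
    by rewrite lift0 cr_exp0 md_scale0l.
  rewrite fE big_ord_recl G0 md_scaler0 md_add0; apply: eq_bigr => i _.
  by rewrite lift0; congr (_ *: G _ _); apply: val_inj; rewrite /= inordK ?ltnS.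
pose Y (j : 'I_n.+1) := if (j : nat) is j'.+1 then X j' else md0 g.
suff -> : sval f = (fun d => \msum_(j < n.+1) (cr_exp (sval d) j *: Y j)).
  by rewrite GK /Y inordK.
apply: functional_extensionality => d.
by rewrite fX big_ord_recl md_scaler0 md_add0.
Qed.

Lemma frac_eq (a c : Z) (b d : positive) :
  Qeq (Qmake a b) (Qmake c d) -> frac L a b = frac L c d.
Proof. by move=> e; congr (line_rat L _); apply/Q2Qc_eq_iff. Qed.

Lemma fracM a b c d : cr_mul (frac L a b) (frac L c d) = frac L (a * c) (b * d).
Proof.
rewrite /frac -(rhM (line_rat_hom L)); congr (line_rat L _).
apply/Q2Qc_eq_iff; exact: (Qmult_comp _ _ (Qred_correct _) _ _ (Qred_correct _)).
Qed.

Lemma fracD a b c d : cr_add (frac L a b) (frac L c d) =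
  frac L (a * Zpos d + c * Zpos b) (b * d).
Proof.
rewrite /frac -(rhD (line_rat_hom L)); congr (line_rat L _).
apply/Q2Qc_eq_iff; exact: (Qplus_comp _ _ (Qred_correct _) _ _ (Qred_correct _)).
Qed.

Lemma frac_unit p : frac L (Zpos p) p = cr1 L.
Proof.
rewrite -(rh1 (line_rat_hom L)) (@frac_eq _ 1 _ 1) //; exact: Z.mul_comm.
Qed.

Lemma fracK p : cr_mul (frac L (Zpos p) 1) (frac L 1 p) = cr1 L.
Proof. by rewrite fracM Z.mul_1_r frac_unit. Qed.

Lemma fracKV p : cr_mul (frac L 1 p) (frac L (Zpos p) 1) = cr1 L.
Proof. by rewrite cr_mulC fracK. Qed.

Lemma jets_eq n (f f' : jets g n) : sval f =1 sval f' -> f = f'.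
Proof. by move=> e; apply: eq_sig_hprop => [h p q|];
  [apply: proof_irrelevance | apply: functional_extensionality]. Qed.

Lemma jet1_bij : bijective (@jet1 L g).
Proof.
have [T [TE TU]] := jet_coords 1.
exists (fun f => T f 0%N) => [X1|f].
  by rewrite (TU _ (fun=> X1)) // => d; rewrite big_ord1 /= cr_mulr1.
by apply: jets_eq => d; rewrite [RHS]TE big_ord1 /= cr_mulr1.
Qed.

(** The second coordinate differs from the Taylor coefficient by the factor
    1/2, which is invertible since the line is a rational algebra. *)
Lemma jet2_bij : bijective (fun X : g * g => jet2 X.1 X.2).
Proof.
have [T [TE TU]] := jet_coords 2.
exists (fun f => (T f 0%N, frac L 2 1 *: T f 1%N)) => [[X1 X2]|f] /=.
  pose Y := nth (md0 g) [:: X1; frac L 1 2 *: X2].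
  have YE d : sval (jet2 X1 X2) d = \msum_(i < 2) (cr_exp (sval d) i.+1 *: Y i).
    rewrite !big_ord_recr big_ord0 /= md_add0 /jet2_fun /Y /= !cr_mulr1.
    by rewrite md_scaleA (cr_mulC (frac L 1 2)).
  by rewrite !(TU _ _ YE) // /Y /= md_scaleA fracK md_scale1.
apply: jets_eq => d; rewrite [RHS]TE !big_ord_recr big_ord0 /= md_add0 /jet2_fun /=.
by rewrite !cr_mulr1 md_scaleA (cr_mulC (frac L 1 2)) -!cr_mulA fracKV !cr_mulr1.
Qed.

Lemma jet3_bij : bijective (fun X : g * g * g => jet3 X.1.1 X.1.2 X.2).
Proof.
have [T [TE TU]] := jet_coords 3.
exists (fun f => (T f 0%N, frac L 2 1 *: T f 1%N, frac L 6 1 *: T f 2%N))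
  => [[[X1 X2] X3]|f] /=.
  pose Y := nth (md0 g) [:: X1; frac L 1 2 *: X2; frac L 1 6 *: X3].
  have YE d : sval (jet3 X1 X2 X3) d =
      \msum_(i < 3) (cr_exp (sval d) i.+1 *: Y i).
    rewrite !big_ord_recr big_ord0 /= md_add0 /jet3_fun /Y /= !cr_mulr1.
    by rewrite !md_scaleA !(cr_mulC (frac L 1 _)).
  by rewrite !(TU _ _ YE) // /Y /= !md_scaleA !fracK !md_scale1.
apply: jets_eq => d; rewrite [RHS]TE !big_ord_recr big_ord0 /= md_add0 /jet3_fun /=.
by rewrite !cr_mulr1 !md_scaleA !(cr_mulC (frac L 1 _)) -!cr_mulA !fracKV !cr_mulr1.
Qed.

End JetCoordinates.

(** * Permanence of microlinearity and transport of group laws *)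

Section Microlinear.
Variable R : cring.

Lemma lim_pow_map_subproof (M N : Type) (C : inf_cocone R) (f : M -> N)
  (h : lim_pow M C) e x :
  f (sval h (ic_tgt C e) (ic_map C e x)) = f (sval h (ic_src C e) x).
Proof. by congr f; apply: (svalP h). Qed.

Definition lim_pow_map (M N : Type) (C : inf_cocone R) (f : M -> N)
  (h : lim_pow M C) : lim_pow N C :=
  exist _ (fun v x => f (sval h v x)) (lim_pow_map_subproof f h).

Lemma microlinear_prod (M N : Type) :
  microlinear R M -> microlinear R N -> microlinear R (M * N).
Proof.
move=> M_micro N_micro C CR.
case: (M_micro C CR) (N_micro C CR) => G GK KG [H HK KH].
exists (fun h x => (G (lim_pow_map fst h) x, H (lim_pow_map snd h) x)) => [f|h].
  apply: functional_extensionality => x.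
  have -> : lim_pow_map fst (pow_cone f) = pow_cone (fun x => (f x).1) by apply: lim_pow_eq.
  have -> : lim_pow_map snd (pow_cone f) = pow_cone (fun x => (f x).2) by apply: lim_pow_eq.
  by rewrite GK HK -surjective_pairing.
apply: lim_pow_eq => v x /=.
have /(congr1 (fun h => sval h v x)) /= -> := KG (lim_pow_map fst h).
have /(congr1 (fun h => sval h v x)) /= -> := KH (lim_pow_map snd h).
by rewrite -surjective_pairing.
Qed.

Lemma microlinear_bij (M N : Type) (b : M -> N) :
  bijective b -> microlinear R M -> microlinear R N.
Proof.
case=> b' bK Kb M_micro C /M_micro [G GK KG].
exists (fun h x => b (G (lim_pow_map b' h) x)) => [f|h].
  apply: functional_extensionality => x.
  have -> : lim_pow_map b' (pow_cone f) = pow_cone (b' \o f) by apply: lim_pow_eq.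
  by rewrite GK /= Kb.
apply: lim_pow_eq => v x /=.
by have /(congr1 (fun h => sval h v x)) /= -> := KG (lim_pow_map b' h).
Qed.

Lemma lie_group_transport (G H : Type) (op : G -> G -> G) (b : G -> H) :
  bijective b -> is_lie_group R op ->
  exists mul : H -> H -> H,
    unique (fun op' : H -> H -> H => forall x y, op' (b x) (b y) = b (op x y)) mul
    /\ is_lie_group R mul.
Proof.
move=> b_bij [[opA [e [inv [op1l op1r opVl opVr]]]] G_micro].
have [b' bK Kb] := b_bij.
exists (fun x y => b (op (b' x) (b' y))); split; last split.
- split=> [x y|op' op'E]; first by rewrite !bK.
  do 2!apply: functional_extensionality => ?.
  by rewrite -op'E !Kb.
- split=> [x y z|]; first by rewrite !bK opA.
  exists (b e), (fun x => b (inv (b' x))).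
  split=> x; rewrite bK; [rewrite op1l Kb|rewrite op1r Kb|rewrite opVl|rewrite opVr] => //.
- exact: (microlinear_bij b_bij).
Qed.

End Microlinear.

(** * The truncated Baker-Campbell-Hausdorff laws *)

Section LieLaws.
Variables (L : line) (g : lie_algebra L).
Local Open Scope sdg_scope.
Add Ring LL_ring : (cr_theory (mod_ring g)).

Lemma br0l (x : g) : [lie md0 g, x] = md0 g.
Proof. by rewrite -{1}(md_scale0l (md0 g)) la_brZl md_scale0l. Qed.

Lemma br0r (x : g) : [lie x, md0 g] = md0 g.
Proof. by rewrite -{1}(md_scale0l (md0 g)) la_brZr md_scale0l. Qed.

Lemma brNl (x y : g) : [lie - x, y] = - [lie x, y].
Proof.
by apply: (@md_addI _ _ [lie x, y]); rewrite -la_brDl !md_addrN br0l.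
Qed.

Lemma brNr (x y : g) : [lie x, - y] = - [lie x, y].
Proof.
by apply: (@md_addI _ _ [lie x, y]); rewrite -la_brDr !md_addrN br0r.
Qed.

Lemma brxx (x : g) : [lie x, x] = md0 g.
Proof.
rewrite -[LHS]md_scale1 -(fracKV L 2) -md_scaleA.
have -> : frac L 2 1 = cr_add (cr1 L) (cr1 L) by rewrite -(frac_unit L 1) fracD.
by rewrite md_scaleDl md_scale1 {2}la_brC md_addrN md_scaler0.
Qed.

(** The Jacobi identity oriented as a rewriting rule, which reduces the double
    brackets of three elements to two independent ones. *)
Lemma br_jacobi (x y z : g) :
  [lie x, [lie y, z]] = [lie y, [lie x, z]] - [lie z, [lie x, y]].
Proof.
have /(congr1 (@emb _ g)) := la_jacobi x y z.
rewrite (la_brC z x) brNr !embE => J; apply: emb_inj; rewrite !embE.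
set a := emb _ in J *; set b := emb _ in J *; set c := emb _ in J *.
have -> : a = cr_add (cr_add (cr_add a (cr_opp b)) c) (cr_add b (cr_opp c)) by ring.
by rewrite J; ring.
Qed.

Definition law1 (X Y : g) := X + Y.

Definition law2 (X Y : g * g) : g * g :=
  (X.1 + Y.1, X.2 + Y.2 + [lie X.1, Y.1]).

Definition law3 (X Y : g * g * g) : g * g * g :=
  (X.1.1 + Y.1.1, X.1.2 + Y.1.2 + [lie X.1.1, Y.1.1],
   X.2 + Y.2 + frac L 3 2 *: ([lie X.1.1, Y.1.2] + [lie X.1.2, Y.1.1])
     + frac L 1 2 *: [lie X.1.1 - Y.1.1, [lie X.1.1, Y.1.1]]).


Lemma law1_group : is_group law1.
Proof.
split; first exact: md_addA.
by exists (md0 g), (@md_opp _ g); split=> x;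
  rewrite /law1 ?md_add0 ?md_addr0 ?md_addN ?md_addrN.
Qed.

Lemma law2_group : is_group law2.
Proof.
split=> [[x1 x2] [y1 y2] [z1 z2]|].
  congr pair; rewrite /= ?la_brDl ?la_brDr; apply: emb_inj; rewrite !embE; ring.
exists (md0 g, md0 g), (fun X => (- X.1, - X.2)).
by split=> -[x1 x2]; congr pair; rewrite /= ?br0l ?br0r ?brNl ?brNr ?brxx;
  apply: emb_inj; rewrite !embE; ring.
Qed.

Lemma frac32 : frac L 3 2 =
  cr_add (frac L 1 2) (cr_add (frac L 1 2) (frac L 1 2)).
Proof.
by rewrite !fracD; apply: frac_eq.
Qed.

(** With h = 1/2, expanding both sides of associativity leaves the difference
    2h ([y,[x,z]] - [z,[x,y]] - [x,[y,z]]) in degree 3, which vanishes by the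
    Jacobi identity. *)
Lemma law3_group : is_group law3.
Proof.
split=> [[[x1 x2] x3] [[y1 y2] y3] [[z1 z2] z3]|].
  congr (_, _, _) => /=.
  - by apply: emb_inj; rewrite !embE; ring.
  - by rewrite ?la_brDl ?la_brDr; apply: emb_inj; rewrite !embE; ring.
  rewrite frac32 !(la_brDl, la_brDr, brNl, brNr).
  rewrite (la_brC [lie x1, y1] z1) (br_jacobi x1 y1 z1).
  apply: emb_inj; rewrite !embE; ring.
exists (md0 g, md0 g, md0 g), (fun X => (- X.1.1, - X.1.2, - X.2)).
by split=> -[[x1 x2] x3]; congr (_, _, _) => /=;
  rewrite ?(la_brDl, la_brDr, brNl, brNr, br0l, br0r, brxx) ?(la_brC x2 x1);
  apply: emb_inj; rewrite !embE; ring.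
Qed.

End LieLaws.

(** * The Lie groups of jets *)

Local Open Scope sdg_scope.

Theorem theorem30 (L : line) (g : lie_algebra L) :
  (exists mul : jets g 1 -> jets g 1 -> jets g 1,
     unique (fun op : jets g 1 -> jets g 1 -> jets g 1 =>
       forall X1 Y1 : g,
         op (jet1 X1) (jet1 Y1) = jet1 (X1 + Y1)) mul
     /\ is_lie_group L mul)
  /\
  (exists mul : jets g 2 -> jets g 2 -> jets g 2,
     unique (fun op : jets g 2 -> jets g 2 -> jets g 2 =>
       forall X1 X2 Y1 Y2 : g,
         op (jet2 X1 X2) (jet2 Y1 Y2)
         = jet2 (X1 + Y1) (X2 + Y2 + [lie X1, Y1])) mul
     /\ is_lie_group L mul)
  /\
  (exists mul : jets g 3 -> jets g 3 -> jets g 3,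
     unique (fun op : jets g 3 -> jets g 3 -> jets g 3 =>
       forall X1 X2 X3 Y1 Y2 Y3 : g,
         op (jet3 X1 X2 X3) (jet3 Y1 Y2 Y3)
         = jet3 (X1 + Y1)
                (X2 + Y2 + [lie X1, Y1])
                (X3 + Y3 + frac L 3 2 *: ([lie X1, Y2] + [lie X2, Y1])
                 + frac L 1 2 *: [lie X1 - Y1, [lie X1, Y1]])) mul
     /\ is_lie_group L mul).
Proof.
have g_micro := @la_microlinear L g.
have g2_micro := microlinear_prod g_micro g_micro.
have g3_micro := microlinear_prod g2_micro g_micro.
split; [|split].
- exact: (lie_group_transport (jet1_bij g) (conj (law1_group g) g_micro)).
- have [mul [[mulE mul_uniq] mul_lie]] :=
    lie_group_transport (jet2_bij g) (conj (law2_group g) g2_micro).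
  exists mul; split=> //; split=> [X1 X2 Y1 Y2|op opE].
    exact: mulE (X1, X2) (Y1, Y2).
  by apply: mul_uniq => -[X1 X2] [Y1 Y2]; apply: opE.
- have [mul [[mulE mul_uniq] mul_lie]] :=
    lie_group_transport (jet3_bij g) (conj (law3_group g) g3_micro).
  exists mul; split=> //; split=> [X1 X2 X3 Y1 Y2 Y3|op opE].
    exact: mulE (X1, X2, X3) (Y1, Y2, Y3).
  by apply: mul_uniq => -[[X1 X2] X3] [[Y1 Y2] Y3]; apply: opE.
Qed.
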